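(* For all positive integers $n$ and $k$ with $k\le 2^n$, we have $v_2\big(s(2^n+1,k+1)\big)=v_2\big(s(2^n,k)\big)$.
   Context: The (unsigned) Stirling numbers of the first kind $s(n,k)$ are defined by $x(x+1)\cdots(x+n-1)=\sum_{k=0}^n s(n,k)x^k$, with $s(n,k)=0$ for $k>n$. $v_2$ denotes the $2$-adic valuation. *)

(* Defs.v *)
From HB Require Import structures.
From mathcomp Require Import all_boot all_order all_algebra.
Set Implicit Arguments. Unset Strict Implicit. Unset Printing Implicit Defensive.
Import GRing.Theory.

Definition rising_poly (n : nat) : {poly nat} :=
  \prod_(i < n) ('X + (i : nat)%:R%:P)%R.

(* Unsigned Stirling numbers of the first kind: coefficient of x^k.
   (Automatically 0 for k > n.) *)
Definition stirling1 (n k : nat) : nat := nth 0%N (polyseq (rising_poly n)) k.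

Definition v2 (m : nat) : nat := logn 2 m.

(* Main.v *)
Require Import Defs.
From mathcomp Require Import all_boot all_order all_algebra.
From mathcomp Require Import zify ring.
Set Implicit Arguments. Unset Strict Implicit. Unset Printing Implicit Defensive.
Import GRing.Theory.

(** Write N = 2^n, M = N/2 and v for the 2-adic valuation.  Since
    s(N+1,k+1) = s(N,k) + N s(N,k+1), it suffices that
    v(s(N,k)) < v(s(N,k+1)) + n for 0 < k < N.

    For k odd, the symmetry Q(-x-N) = -Q(x) of Q(x) = (x+1)...(x+N-1) expresses
    2 s(N,k) as k N s(N,k+1) plus terms N^d s(N,k+d) with d >= 2; by descending
    induction on k the first term dominates, so that
    v(s(N,k)) = v(s(N,k+1)) + n - 1.

    For k even it then remains to see that v(s(N,k)) <= v(s(N,k+2)) + 2(n-1).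
    If k >= M, this follows from x(x+1)...(x+N-1) = (x(x+1))^M modulo M, as M does
    not divide binomial(M, k-M).  If k <= M, split the product into its even
    factors, whose coefficients are 2^(M-k) s(M,k), and its odd factors O(x), whose
    derivative vanishes modulo M; this yields v(s(N,k)) = M - k + v(s(M,k)), and
    one concludes by induction on n. *)

(** * Valuations of sums and of binomial coefficients near powers of 2 *)

Lemma logn_add_dvd (p a b : nat) :
  prime p -> 0 < a -> p ^ (logn p a).+1 %| b -> logn p (a + b) = logn p a.
Proof.
move=> pr_p a0 hb; have ab0 : 0 < a + b by rewrite addn_gt0 a0.
apply/eqP; rewrite eqn_leq leqNgt -!pfactor_dvdn // dvdn_addl // pfactor_dvdn //.
rewrite ltnn dvdn_add ?pfactor_dvdnn //.
by apply: dvdn_trans hb; rewrite dvdn_exp2l.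
Qed.

Lemma logn2_lt (j : nat) : 0 < j -> logn 2 j < j.
Proof.
move=> j0; apply: leq_trans (ltn_expl _ (isT : 1 < 2)) _.
by apply: dvdn_leq j0 _; apply: pfactor_dvdnn.
Qed.

Lemma bin_pow2_mul (m j : nat) :
  j.+1 * 'C(2 ^ m, j.+1) = 2 ^ m * 'C((2 ^ m).-1, j).
Proof. by rewrite -mul_bin_diag. Qed.

Lemma bin_pow2_even (m j : nat) : 0 < j < 2 ^ m -> ~~ odd 'C(2 ^ m, j).
Proof.
case: j => // j /andP[_ lt_j].
rewrite -dvdn2 (@pfactor_dvdn 2 1) ?bin_gt0 ?(ltnW lt_j) //.
have /(congr1 (logn 2)) := bin_pow2_mul m j.
rewrite !lognM ?bin_gt0 ?expn_gt0 ?(ltnW lt_j) //; last by move: lt_j; lia.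
rewrite pfactorK // => E.
(* By [E], the valuation of the binomial is at least m minus that of [j.+1]. *)
suff : logn 2 j.+1 < m by lia.
rewrite -(ltn_exp2l _ _ (isT : 1 < 2)); apply: leq_ltn_trans lt_j.
by apply: dvdn_leq => //; apply: pfactor_dvdnn.
Qed.

(** Neighbours in row 2^m - 1 add up to an even entry of row 2^m, so the parity of the first entry
    propagates. *)
Lemma bin_pow2_pred_odd (m j : nat) : j < 2 ^ m -> odd 'C((2 ^ m).-1, j).
Proof.
elim: j => [|j IH] lt_j; first by rewrite bin0.
have := @bin_pow2_even m j.+1; rewrite lt_j => /(_ isT).
rewrite -{1}[2 ^ m]prednK ?expn_gt0 //.
by rewrite binS oddD (IH (ltnW lt_j)) addbT negbK.
Qed.

Lemma bin_pow2_ndvd (m j : nat) :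
  0 < m -> ~~ odd j -> j <= 2 ^ m -> ~~ (2 ^ m %| 'C(2 ^ m, j)).
Proof.
case: j => [|j] m0 ev lt_j.
  by rewrite bin0 dvdn1 -(expn0 2) eqn_exp2l //; lia.
(* Cancelling 2^m would make an odd binomial a multiple of the even number [j.+1]. *)
apply/negP => /dvdnP[c Ec]; have /eqP := bin_pow2_mul m j.
rewrite Ec mulnA mulnC eqn_pmul2l ?expn_gt0 // => /eqP/(congr1 odd).
by rewrite bin_pow2_pred_odd // oddM (negbTE ev).
Qed.

(** * Recurrence and support of the Stirling numbers *)

Lemma stirling1S (n k : nat) :
  stirling1 n.+1 k.+1 = stirling1 n k + n * stirling1 n k.+1.
Proof.
rewrite /stirling1 /rising_poly big_ord_recr /= mulrDr coefD coefMX coefMC /=.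
by rewrite natn [RHS]addnC mulnC addnC.
Qed.

Lemma stirling1_S0 (n : nat) : stirling1 n.+1 0 = 0.
Proof.
rewrite /stirling1 /rising_poly big_ord_recl /= mulrC addr0.
by rewrite coefMX.
Qed.

Lemma stirling1_00 : stirling1 0 0 = 1.
Proof. by rewrite /stirling1 /rising_poly big_ord0 coef1. Qed.

Lemma stirling1_0S (k : nat) : stirling1 0 k.+1 = 0.
Proof. by rewrite /stirling1 /rising_poly big_ord0 coef1. Qed.

Lemma stirling1_gt (n k : nat) : n < k -> stirling1 n k = 0.
Proof.
elim: n k => [|n IH] [|k] //; first by rewrite stirling1_0S.
by move=> lt_nk; rewrite stirling1S !IH ?muln0 // ltnW.
Qed.

Lemma stirling1_gt0 (n k : nat) : 0 < k <= n -> 0 < stirling1 n k.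
Proof.
elim: n k => [|n IH] [|k] //; rewrite stirling1S => le_kn.
case: k le_kn => [|k] le_kn; last by rewrite addn_gt0 (IH k.+1).
case: n IH {le_kn} => [|n] IH; first by rewrite stirling1_00.
by rewrite addn_gt0 muln_gt0 (IH 1) ?orbT.
Qed.

(** * Shifted polynomials and congruences for rising products *)

Lemma coef_XaddC_exp (R : comNzSemiRingType) (c : R) (i j : nat) :
  ((('X + c%:P) ^+ i)`_j = c ^+ (i - j) *+ 'C(i, j))%R.
Proof.
elim: i j => [|i IH] j.
  by rewrite expr0 coef1; case: j => [|j]; rewrite ?bin0 ?bin0n ?expr0.
rewrite exprSr mulrDr coefD coefMX coefMC.
case: j => [|j] /=; rewrite !IH.
  by rewrite !bin0 !subn0 !mulr1n add0r -exprSr.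
rewrite subSS binS mulrnDr addrC; congr (_ + _)%R.
case: (leqP j.+1 i) => [lt_ji|le_ij]; last by rewrite bin_small ?mulr0n ?mul0r.
by rewrite mulrnAl -exprSr -subSn // subSS.
Qed.

Lemma comp_XaddC_mod (c : nat) (p : {poly nat}) :
  exists g : {poly nat}, (p \Po ('X + c%:P) = p + g * c%:P)%R.
Proof.
elim/poly_ind: p => [|p a [g Eg]].
  by exists 0%R; rewrite comp_poly0 mul0r addr0.
exists (g * ('X + c%:P) + p)%R.
rewrite comp_polyD comp_polyM comp_polyX comp_polyC Eg; ring.
Qed.

Lemma prod_comp_XaddC (f : nat -> nat) (m c : nat) :
  ((\prod_(i < m) ('X + (f i)%:P)) \Po ('X + c%:P)
   = \prod_(i < m) ('X + (c + f i)%N%:P) :> {poly nat})%R.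
Proof.
rewrite rmorph_prod; apply: eq_bigr => i _.
by rewrite /= comp_polyD comp_polyX comp_polyC -addrA -polyCD.
Qed.

Lemma rising_polyE (m : nat) :
  rising_poly m = (\prod_(i < m) ('X + (i : nat)%:P))%R.
Proof. by apply: eq_bigr => i _; rewrite natn. Qed.

Lemma rising_poly_addn (m : nat) :
  (rising_poly (m + m) = rising_poly m * (rising_poly m \Po ('X + m%:P)))%R.
Proof.
by rewrite !rising_polyE big_split_ord /= (prod_comp_XaddC id).
Qed.

Definition odd_rising (m : nat) : {poly nat} :=
  (\prod_(i < m) ('X + (i.*2.+1)%:P))%R.

Lemma odd_rising_addn (m : nat) :
  (odd_rising (m + m) = odd_rising m * (odd_rising m \Po ('X + m.*2%:P)))%R.
Proof.
rewrite /odd_rising big_split_ord /= (prod_comp_XaddC (fun i => i.*2.+1)).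
by congr (_ * _)%R; apply: eq_bigr => i _; rewrite doubleD addnS.
Qed.

(** Doubling the length N multiplies the product by its shift by N, hence squares it modulo N;
    squaring also doubles the modulus of the inductive congruence. *)
Lemma rising_poly_pow2_mod (m : nat) :
  exists h : {poly nat},
    (rising_poly (2 ^ m.+2)
     = ('X * ('X + 1)) ^+ (2 ^ m.+1) + h * (2 ^ m.+1)%N%:P)%R.
Proof.
elim: m => [|m [h IH]].
  rewrite (rising_poly_addn 2).
  have [g ->] := comp_XaddC_mod 2 (rising_poly 2).
  have -> : (rising_poly 2 = 'X * ('X + 1))%R.
    rewrite rising_polyE !big_ord_recr big_ord0 /=.
    by rewrite mul1r polyC0 addr0 polyC1.
  by exists ('X * ('X + 1) * g)%R; rewrite expn1; ring.
rewrite [in rising_poly _]expnS mul2n -addnn rising_poly_addn.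
have [g ->] := comp_XaddC_mod (2 ^ m.+2) (rising_poly (2 ^ m.+2)).
rewrite IH.
exists (('X * ('X + 1)) ^+ (2 ^ m.+1) * h + h ^+ 2 * (2 ^ m)%N%:P
  + (('X * ('X + 1)) ^+ (2 ^ m.+1) + h * (2 ^ m.+1)%N%:P) * g)%R.
have -> : (('X * ('X + 1) : {poly nat}) ^+ (2 ^ m.+2)
           = ('X * ('X + 1)) ^+ (2 ^ m.+1) * ('X * ('X + 1)) ^+ (2 ^ m.+1))%R.
  by rewrite [2 ^ m.+2]expnS mul2n -addnn exprD.
by rewrite !expnS !mul2n -!addnn !polyCD; ring.
Qed.

(** Doubling turns O(x) into O(x) O(x + 2^(m+1)), whose derivative is 2 O O' modulo 2^(m+1); the
    factor 2 raises the power dividing O'. *)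
Lemma deriv_odd_rising_pow2 (m : nat) :
  exists h : {poly nat}, ((odd_rising (2 ^ m))^`() = h * (2 ^ m)%N%:P)%R.
Proof.
elim: m => [|m [h IH]]; first by exists (odd_rising (2 ^ 0))^`()%R; rewrite mulr1.
rewrite expnS mul2n -addnn odd_rising_addn derivM deriv_comp derivD derivX derivC.
rewrite IH addr0 mulr1 comp_polyM comp_polyC.
have [g ->] := comp_XaddC_mod (2 ^ m).*2 (odd_rising (2 ^ m)).
have [g' ->] := comp_XaddC_mod (2 ^ m).*2 h.
exists (h * odd_rising (2 ^ m) + (h * g + odd_rising (2 ^ m) * g') * (2 ^ m)%N%:P)%R.
by rewrite -!addnn !polyCD; ring.
Qed.

Lemma dvdn_odd_rising_coef (m j : nat) : 2 ^ m %| j * ((odd_rising (2 ^ m))`_j)%R.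
Proof.
case: j => [|j]; first by rewrite mul0n.
have [h Eh] := deriv_odd_rising_pow2 m.
have := coef_deriv (odd_rising (2 ^ m)) j; rewrite Eh coefMC => E.
have -> : j.+1 * ((odd_rising (2 ^ m))`_j.+1)%R = (h`_j)%R * 2 ^ m.
  by rewrite [RHS]E -mulr_natl natn.
exact: dvdn_mull.
Qed.

Lemma odd_rising_coef0 (m : nat) : odd ((odd_rising m)`_0)%R.
Proof.
elim: m => [|m IH]; first by rewrite /odd_rising big_ord0 coef1.
rewrite /odd_rising big_ord_recr /= mulrDr coefD coefMX coefMC /= add0r.
by rewrite [(_ * _)%R]/(_ * _)%N oddM IH /= odd_double.
Qed.

(** * Splitting the rising product into even and odd factors *)

Definition even_rising (m : nat) : {poly nat} :=
  (\prod_(i < m) ('X + (i.*2)%:P))%R.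

Lemma even_rising_coef (m k : nat) :
  ((even_rising m)`_k)%R = 2 ^ (m - k) * stirling1 m k.
Proof.
elim: m k => [|m IH] k.
  rewrite /even_rising big_ord0 coef1 mul1n.
  by case: k => [|k]; rewrite ?stirling1_00 ?stirling1_0S.
rewrite /even_rising big_ord_recr /= mulrDr coefD coefMX coefMC.
case: k => [|k] /=.
  rewrite -/(even_rising m) IH stirling1_S0.
  case: m {IH} => [|m]; first by rewrite mulr0 !muln0.
  by rewrite stirling1_S0 !muln0 mul0r.
rewrite -/(even_rising m) !IH stirling1S subSS.
transitivity (2 ^ (m - k) * stirling1 m k + 2 ^ (m - k.+1) * stirling1 m k.+1 * m.*2) => //.
rewrite mulnDr; congr (_ + _).
(* For k >= m the subtraction in the exponent truncates, but the Stirling number vanishes. *)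
case: (ltnP k m) => [lt_km|le_mk]; last by rewrite stirling1_gt // !muln0.
by rewrite -(subnSK lt_km) expnS -mul2n; ring.
Qed.

Lemma rising_poly_double (m : nat) :
  (rising_poly m.*2 = even_rising m * odd_rising m)%R.
Proof.
elim: m => [|m IH].
  by rewrite rising_polyE /even_rising /odd_rising !big_ord0 mul1r.
rewrite rising_polyE doubleS 2!big_ord_recr /= -rising_polyE IH.
by rewrite /even_rising /odd_rising !big_ord_recr /=; ring.
Qed.

Lemma stirling1_double (m k : nat) :
  stirling1 m.*2 k
  = \sum_(j < k.+1) 2 ^ (m - (k - j)) * stirling1 m (k - j) * ((odd_rising m)`_j)%R.
Proof.
rewrite /stirling1 rising_poly_double mulrC coefM.
by apply: eq_bigr => j _; rewrite even_rising_coef mulrC.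
Qed.

(** * Valuation bounds for s(2^n, k), chiefly at even k *)

Lemma stirling1_pow2_ndvd (n k : nat) :
  ~~ odd k -> 2 ^ n.+1 <= k <= 2 ^ n.+2 ->
  ~~ (2 ^ n.+1 %| stirling1 (2 ^ n.+2) k).
Proof.
move=> ev /andP[le_k ge_k]; have [h Eh] := rising_poly_pow2_mod n.
rewrite /stirling1 Eh exprMn coefD coefXnM coefMC ltnNge le_k /=.
rewrite -[1%R]polyC1 coef_XaddC_exp expr1n natn.
rewrite [(_ + _)%R]/(_ + _)%N dvdn_addl; last exact: dvdn_mull.
apply: bin_pow2_ndvd => //; last by move: ge_k; rewrite (expnS _ n.+1); lia.
by rewrite oddB // (negbTE ev) oddX.
Qed.

Lemma pfactor_dvdn_odd_rising_coef (n j : nat) :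
  0 < j -> 2 ^ (n - logn 2 j) %| ((odd_rising (2 ^ n))`_j)%R.
Proof.
move=> j0; have := dvdn_odd_rising_coef n j.
(* A zero coefficient is treated apart, since [logn 2 0] is 0. *)
case: (posnP ((odd_rising (2 ^ n))`_j)%R) => [-> //|c0].
by rewrite !pfactor_dvdn ?muln_gt0 ?j0 // lognM // leq_subLR.
Qed.

Lemma stirling1_pow2_0 (n : nat) : stirling1 (2 ^ n) 0 = 0.
Proof. by rewrite -[2 ^ n]prednK ?expn_gt0 // stirling1_S0. Qed.

(** In the even-odd expansion the term j = 0 dominates: its odd-part coefficient is odd, while the
    term j > 0 gains j + n - v(j) > n from the powers of 2 and loses at most n by hypothesis. *)
Lemma logn_stirling1_pow2_lower (n k : nat) :
  (forall k', 0 < k' <= k ->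
    logn 2 (stirling1 (2 ^ n) k) <= logn 2 (stirling1 (2 ^ n) k') + n) ->
  0 < k <= 2 ^ n ->
  logn 2 (stirling1 (2 ^ n.+1) k) = 2 ^ n - k + logn 2 (stirling1 (2 ^ n) k).
Proof.
move=> slow_k k_bnd; have s0 := stirling1_gt0 k_bnd.
have o0 := odd_rising_coef0 (2 ^ n).
rewrite expnS mul2n stirling1_double big_ord_recl /= subn0.
set a := (X in logn 2 (X + _)).
have ao : 0 < ((odd_rising (2 ^ n))`_0)%R by rewrite lt0n; case: eqP o0 => // ->.
have a0 : 0 < a by rewrite !muln_gt0 expn_gt0 s0.
have va : logn 2 a = 2 ^ n - k + logn 2 (stirling1 (2 ^ n) k).
  rewrite /a !lognM ?muln_gt0 ?expn_gt0 ?s0 // pfactorK //.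
  by rewrite [X in _ + X]lognE dvdn2 o0 andbF addn0.
rewrite -[RHS]va; apply: logn_add_dvd => //; rewrite va.
apply: dvdn_sum => -[j lt_jk] _; rewrite /bump /= add1n.
case: (posnP (k - j.+1)) => [->|k'0]; first by rewrite stirling1_pow2_0 muln0.
have k'_bnd : 0 < k - j.+1 <= k by rewrite k'0 leq_subr.
have le_v := slow_k _ k'_bnd.
have s'0 : 0 < stirling1 (2 ^ n) (k - j.+1) by apply: stirling1_gt0; lia.
have v_j := @logn2_lt j.+1 isT.
have := pfactor_dvdn_odd_rising_coef n (isT : 0 < j.+1).
have := pfactor_dvdnn 2 (stirling1 (2 ^ n) (k - j.+1)).
move=> d1 d2.
have := dvdn_mul (dvdn_mul (dvdnn (2 ^ (2 ^ n - (k - j.+1)))) d1) d2.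
apply: dvdn_trans; rewrite -!expnD; apply: dvdn_exp2l.
by lia.
Qed.

Lemma logn_stirling1_pow2_upper (n k : nat) :
  ~~ odd k -> 2 ^ n <= k <= 2 ^ n.+1 -> 0 < k ->
  logn 2 (stirling1 (2 ^ n.+1) k) <= n.
Proof.
case: n => [|n] ev k_bnd k0.
  (* The congruence starts at row 4, so row 2 is computed directly. *)
  have -> : k = 2 by move: ev k_bnd; case: k k0 => [|[|[|k]]].
  by rewrite !stirling1S !stirling1_00 !stirling1_0S.
have := stirling1_pow2_ndvd ev k_bnd.
rewrite pfactor_dvdn // ?stirling1_gt0 ?k0 //; first by lia.
by case/andP: k_bnd.
Qed.

(** Supplies the hypothesis of [logn_stirling1_pow2_lower] at even k. For k in the upper half the
    bound n alone suffices; otherwise, by induction, every term of the expansion of s(2^(n+1), k')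
    is divisible enough. *)
Lemma logn_stirling1_pow2_slow (n k k' : nat) :
  ~~ odd k -> 0 < k <= 2 ^ n -> 0 < k' <= k ->
  logn 2 (stirling1 (2 ^ n) k) <= logn 2 (stirling1 (2 ^ n) k') + n.
Proof.
elim: n k k' => [|n IH] k k' ev; first by case: k ev => [|[|k]].
move=> k_bnd k'_bnd; have k0 : 0 < k by lia.
case: (leqP k (2 ^ n)) => [le_k|gt_k]; last first.
  apply: leq_trans (logn_stirling1_pow2_upper ev _ k0) _; lia.
have slow_k k'' : 0 < k'' <= k ->
    logn 2 (stirling1 (2 ^ n) k) <= logn 2 (stirling1 (2 ^ n) k'') + n.
  by move=> k''_bnd; apply: IH => //; lia.
rewrite logn_stirling1_pow2_lower //; last by lia.
suff d : 2 ^ (2 ^ n - k + logn 2 (stirling1 (2 ^ n) k) - n)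
     %| stirling1 (2 ^ n.+1) k'.
  move: d; rewrite pfactor_dvdn ?stirling1_gt0 //; lia.
rewrite [2 ^ n.+1]expnS mul2n stirling1_double.
apply: dvdn_sum => -[j lt_jk] _ /=; apply: dvdn_mulr.
case: (posnP (k' - j)) => [->|k''0]; first by rewrite stirling1_pow2_0 muln0.
have le_v : logn 2 (stirling1 (2 ^ n) k)
    <= logn 2 (stirling1 (2 ^ n) (k' - j)) + n by apply: slow_k; lia.
have := pfactor_dvdnn 2 (stirling1 (2 ^ n) (k' - j)).
move/(dvdn_mul (dvdnn (2 ^ (2 ^ n - (k' - j))))).
apply: dvdn_trans; rewrite -!expnD; apply: dvdn_exp2l.
by lia.
Qed.

Lemma logn_stirling1_pow2_step2 (n k : nat) :
  ~~ odd k -> 0 < k -> k.+2 <= 2 ^ n ->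
  logn 2 (stirling1 (2 ^ n) k) <= logn 2 (stirling1 (2 ^ n) k.+2) + (n.-1).*2.
Proof.
elim: n k => [|n IH] k ev k0 k_bnd; first by move: k_bnd; case: k {ev k0}.
case: (leqP k.+2 (2 ^ n)) => [le_k|gt_k].
  have := IH k ev k0 le_k.
  have slow j : ~~ odd j -> 0 < j <= 2 ^ n ->
    logn 2 (stirling1 (2 ^ n.+1) j) = 2 ^ n - j + logn 2 (stirling1 (2 ^ n) j).
    move=> evj j_bnd; apply: logn_stirling1_pow2_lower => // j' j'_bnd.
    exact: logn_stirling1_pow2_slow.
  (* Passing from row 2^n to row 2^(n+1) raises the difference of the two valuations by exactly
     2. *)
  rewrite !slow ?negbK //; try lia.
  have : 0 < n by case: n le_k {IH slow k_bnd} => //; lia.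
  lia.
(* By parity: k and 2^n are even unless n = 0. *)
have le_k : 2 ^ n <= k.
  case: n gt_k {IH k_bnd} => [|n]; first by lia.
  rewrite expnS; move: ev k0; lia.
have k_bnd' : 2 ^ n <= k <= 2 ^ n.+1 by lia.
have := logn_stirling1_pow2_upper ev k_bnd' k0; lia.
Qed.

(** * Reflection symmetry of (x+1)...(x+m) over the integers *)

Local Open Scope ring_scope.

Definition risingz (m : nat) : {poly int} := \prod_(i < m) ('X + (i.+1)%:R%:P).

Lemma coef_risingz (m k : nat) : (risingz m)`_k = (stirling1 m.+1 k.+1)%:R.
Proof.
elim: m k => [|m IH] k.
  rewrite /risingz big_ord0 coef1 stirling1S stirling1_0S muln0 addn0.
  by case: k => [|k]; rewrite ?stirling1_00 ?stirling1_0S.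
rewrite /risingz big_ord_recr /= mulrDr coefD coefMX coefMC -/(risingz m).
rewrite stirling1S natrD natrM !IH mulrC.
by case: k => [|k] /=; rewrite ?IH ?stirling1_S0.
Qed.

(** The substitution sends x + i + 1 to -(x + m - i), so it reverses the factors up to sign. *)
Lemma risingz_reflect (m : nat) :
  risingz m \Po (- ('X + (m.+1)%:R%:P)) = (-1) ^+ m * risingz m.
Proof.
rewrite /risingz rmorph_prod /= (reindex_inj rev_ord_inj) /=.
rewrite -[in (-1) ^+ m](card_ord m) -prodrN; apply: eq_bigr => i _.
have -> : (m.+1)%:R = (m - i.+1).+1%:R + i.+1%:R :> int.
  by rewrite -natrD addSn subnK.
by rewrite comp_polyD comp_polyX comp_polyC polyCD; ring.
Qed.

Lemma size_risingz (m : nat) : (size (risingz m) <= m.+1)%N.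
Proof. by apply/leq_sizeP => j lt_mj; rewrite coef_risingz stirling1_gt. Qed.

Lemma coef_comp_XaddCN (R : comNzRingType) (p : {poly R}) (c : R) (m k : nat) :
  (size p <= m)%N ->
  (p \Po (- ('X + c%:P)))`_k
  = \sum_(i < m) (-1) ^+ i * p`_i * (c ^+ (i - k) *+ 'C(i, k)).
Proof.
move=> le_pm; rewrite coef_comp_poly.
rewrite (big_ord_widen m (fun i => p`_i * ((- ('X + c%:P)) ^+ i)`_k)) //.
rewrite big_mkcond; apply: eq_bigr => i _; case: ltnP => [_|le_pi].
  rewrite (exprNn ('X + c%:P)) -coef_XaddC_exp -(signr_odd R i) -(signr_odd {poly R} i).
  by case: odd; rewrite ?expr1 ?expr0 ?mulN1r ?mul1r ?coefN ?mulrN ?mulNr.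
by rewrite nth_default // mulr0 mul0r.
Qed.

Lemma stirling1_reflect (m k : nat) : odd m ->
  - (stirling1 m.+1 k.+1)%:R
  = \sum_(i < m.+1) (-1) ^+ i * (stirling1 m.+1 i.+1)%:R
      * ((m.+1)%:R ^+ (i - k) *+ 'C(i, k)) :> int.
Proof.
move=> odd_m.
have := congr1 (fun p : {poly int} => p`_k) (risingz_reflect m).
rewrite (coef_comp_XaddCN _ _ (size_risingz m)).
rewrite -(signr_odd {poly int} m) odd_m expr1 mulN1r coefN coef_risingz => <-.
by apply: eq_bigr => i _; rewrite coef_risingz.
Qed.

Local Close Scope ring_scope.

(** * Odd indices, descending induction and conclusion *)

Lemma logn_eq_mod (p a b : nat) : prime p -> 0 < a -> 0 < b ->
  ((p ^ (logn p b).+1)%N %| (a%:Z - b%:Z)%R)%Z -> logn p a = logn p b.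
Proof.
move=> pr_p a0 b0; rewrite -eqz_mod_dvd => /eqP; rewrite !modz_nat => -[] Eab.
apply/eqP; rewrite eqn_leq leqNgt -!pfactor_dvdn //.
have dvd_ab e : e <= (logn p b).+1 -> (p ^ e %| a) = (p ^ e %| b).
  move=> le_e; have d := dvdn_exp2l p le_e.
  by rewrite /dvdn -(modn_dvdm a d) Eab modn_dvdm.
by rewrite !dvd_ab // pfactor_dvdnn pfactor_dvdn // ltnn.
Qed.

Lemma logn_stirling1_pow2_odd (n k : nat) :
  odd k -> k < 2 ^ n ->
  (forall i, k < i < 2 ^ n ->
    logn 2 (stirling1 (2 ^ n) i) < logn 2 (stirling1 (2 ^ n) i.+1) + n) ->
  (logn 2 (stirling1 (2 ^ n) k)).+1 = logn 2 (stirling1 (2 ^ n) k.+1) + n.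
Proof.
case: k => // k0; set k := k0.+1 => odd_k lt_k.
have oddN1 : odd (2 ^ n).-1.
  case: (n) lt_k => [|n' _]; first by rewrite expn0.
  by rewrite -[odd _]negbK -oddS prednK ?expn_gt0 // oddX.
move: oddN1 lt_k; set N := 2 ^ n; set s := stirling1 N => oddN1 lt_k slope.
set e := logn 2 (s k.+1).
(* Telescopes [slope] from k + 1 to k + d + 2. *)
have tail d : k + d.+2 <= N -> e < logn 2 (s (k + d.+2)) + d.+1 * n.
  elim: d => [|d IH] le_d.
    have := slope k.+1; rewrite mul1n addn2 -/s -/e; apply; lia.
  have := slope (k + d.+2); have := IH ltac:(lia).
  rewrite -/s -addnS; lia.
have sk0 : 0 < s k by apply: stirling1_gt0; lia.
have sk1 : 0 < s k.+1 by apply: stirling1_gt0; lia.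
have N0 : 0 < N by rewrite expn_gt0.
have vb : logn 2 (k * N * s k.+1) = e + n.
  by rewrite !lognM ?muln_gt0 // pfactorK // lognE dvdn2 odd_k andbF addnC.
have <- : logn 2 (2 * s k) = (logn 2 (s k)).+1 by rewrite lognM.
rewrite -vb; apply: logn_eq_mod; rewrite ?muln_gt0 ?sk0 ?N0 //.
rewrite vb.
(* Compare coefficients at k - 1: the terms i = k - 1 and i = k are s(k) and -k N s(k+1), as k - 1
   is even. *)
have := stirling1_reflect k0 oddN1; rewrite prednK // -/s -/k.
have lt_k0 : k0 < N by apply: ltnW.
rewrite (bigD1 (Ordinal lt_k0)) //= (bigD1 (Ordinal lt_k)) /=; last first.
  by rewrite -val_eqE /= /k; lia.
set rest := (\sum_(i < N | _) _)%R.
rewrite subnn binn expr0 mulr1n mulr1 /k subSnn expr1 binSn -/k.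
have -> : ((-1) ^+ k0 = 1 :> int)%R by rewrite -signr_odd (negbTE (odd_k : ~~ odd k0)).
have -> : ((-1) ^+ k = -1 :> int)%R by rewrite -signr_odd odd_k.
rewrite mul1r => E.
have -> : ((2 * s k)%:Z - (k * N * s k.+1)%:Z = - rest)%R.
  rewrite !PoszM -!natz; apply/eqP; rewrite -subr_eq0; apply/eqP.
  transitivity ((s k)%:R + ((s k)%:R + (-1 * (s k.+1)%:R * (N%:R *+ k) + rest)) :> int)%R.
    by ring.
  by rewrite -E subrr.
rewrite rpredN; apply: rpred_sum => -[i lt_i] /=.
rewrite -!val_eqE /= => /andP[ne_k0 ne_k].
case: (ltnP i k0) => [lt_ik|le_ki]; first by rewrite bin_small // mulr0n mulr0 dvdz0.
have [d Ed] : exists d, i = (k + d).+1 by exists (i - k.+1); move: ne_k0 ne_k; rewrite /k; lia.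
rewrite -mulrA; apply: dvdz_mull; rewrite mulrnAr -[(_ *+ 'C(_, _))%R]mulr_natr.
apply: dvdz_mulr.
have -> : i - k0 = d.+2 by rewrite Ed /k; lia.
rewrite -natrX -natrM natz dvdzE /=.
have le_i : k + d.+2 <= N by lia.
have -> : i.+1 = k + d.+2 by rewrite Ed; lia.
have := dvdn_mul (pfactor_dvdnn 2 (s (k + d.+2))) (dvdnn (N ^ d.+2)).
apply: dvdn_trans; rewrite -expnM -expnD; apply: dvdn_exp2l.
(* N^(d+2) adds (d+2) n, one n more than [tail] needs, so the valuation exceeds e + n. *)
by have := tail d le_i; rewrite mulSn !mulnS; lia.
Qed.

Lemma logn_stirling1_pow2_step (n k : nat) :
  0 < k < 2 ^ n ->
  logn 2 (stirling1 (2 ^ n) k) < logn 2 (stirling1 (2 ^ n) k.+1) + n.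
Proof.
have [m] := ubnP (2 ^ n - k); elim: m k => // m IH k lt_m /andP[k0 lt_k].
have odd_step j : odd j -> k <= j -> j < 2 ^ n ->
    (logn 2 (stirling1 (2 ^ n) j)).+1 = logn 2 (stirling1 (2 ^ n) j.+1) + n.
  move=> odd_j le_kj lt_j; apply: logn_stirling1_pow2_odd => // i i_bnd.
  by apply: IH; lia.
case: (boolP (odd k)) => [odd_k|ev_k]; first by rewrite odd_step.
have lt_k1 : k.+1 < 2 ^ n.
  case: (n) lt_k => [|n']; first by lia.
  by rewrite expnS; move: ev_k; lia.
(* For even k, the exact drop n - 1 from k + 1 to k + 2 leaves at most n - 1 of the two-step bound
   2(n-1). *)
have := logn_stirling1_pow2_step2 ev_k k0 lt_k1.
have := odd_step k.+1 ev_k (leqnSn k) lt_k1.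
have : 0 < n by case: (n) lt_k => //; lia.
by lia.
Qed.

Theorem theorem1p2 (n k : nat) :
  0 < n -> 0 < k -> k <= 2 ^ n ->
  v2 (stirling1 (2 ^ n).+1 k.+1) = v2 (stirling1 (2 ^ n) k).
Proof.
move=> _ k0 le_k; rewrite /v2 stirling1S.
apply: logn_add_dvd; rewrite ?stirling1_gt0 ?k0 //.
(* At k = 2^n the added term is zero. *)
move: le_k; rewrite leq_eqVlt => /predU1P[->|lt_k].
  by rewrite (stirling1_gt (ltnSn _)) muln0.
have := dvdn_mul (dvdnn (2 ^ n)) (pfactor_dvdnn 2 (stirling1 (2 ^ n) k.+1)).
apply: dvdn_trans; rewrite -expnD; apply: dvdn_exp2l.
by rewrite addnC logn_stirling1_pow2_step // k0.
Qed.
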